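(* Let $p$ be an odd prime, let $q\in\mathbb{C}_p$ with $|1-q|_p<p^{-1/(p-1)}$, and let $h\in\mathbb{N}$. Let $n,k\in\mathbb{N}^{\ast}$ with $n>k$. Then $$\sum_{l=0}^{n-k}\binom{n-k}{l}(-1)^l\frac{G_{l+k+1,q}^{(h)}}{l+k+1}=\begin{cases}[2]_q+\dfrac{q^{h+1}}{n+1}G_{n+1,q^{-1}}^{(h)} & \text{if } k=0,\\[2mm] \displaystyle\sum_{l=0}^{k}\binom{k}{l}(-1)^{k+l}\left([2]_q+\frac{q^{h+1}}{n-l+1}G_{n-l+1,q^{-1}}^{(h)}\right) & \text{if } k>0.\end{cases}$$
   Context: Here $\mathbb{N}=\{1,2,\dots\}$, $\mathbb{N}^{\ast}=\mathbb{N}\cup\{0\}$; $\mathbb{C}_p$ is the completion of an algebraic closure of $\mathbb{Q}_p$ with absolute value normalized by $|p|_p=p^{-1}$. For $|x|_p\le 1$, $q^x=\exp(x\log q)$. Put $[x]_q=\frac{1-q^x}{1-q}$ (with $[x]_1=x$), so $[2]_q=1+q$, and $[x]_{-q}=\frac{1-(-q)^x}{1+q}$ for $x\in\mathbb{N}$. The fermionic $p$-adic $q$-integral of a uniformly differentiable $f:\mathbb{Z}_p\to\mathbb{C}_p$ is $$\int_{\mathbb{Z}_p}f(x)\,d\mu_{-q}(x)=\lim_{N\to\infty}\frac{1}{[p^N]_{-q}}\sum_{x=0}^{p^N-1}(-1)^xf(x)q^x.$$ The $(h,q)$-Genocchi polynomials are defined by $G_{0,q}^{(h)}(x)=0$ and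 $\frac{G_{n+1,q}^{(h)}(x)}{n+1}=\int_{\mathbb{Z}_p}q^{(h-1)y}[x+y]_q^n\,d\mu_{-q}(y)$ for $n\in\mathbb{N}^{\ast}$, $x\in\mathbb{Z}_p$; the $(h,q)$-Genocchi numbers are $G_{n,q}^{(h)}=G_{n,q}^{(h)}(0)$. $G_{n,q^{-1}}^{(h)}$ is obtained by replacing $q$ by $q^{-1}$ throughout. *)

(* Defs.v *)
From HB Require Import structures.
From mathcomp Require Import all_boot all_order all_algebra.
From mathcomp Require Import all_classical all_reals all_analysis.

Set Implicit Arguments.
Unset Strict Implicit.
Unset Printing Implicit Defensive.

Import Order.TTheory GRing.Theory Num.Theory.
Import numFieldNormedType.Exports.

Local Open Scope classical_set_scope.
Local Open Scope ring_scope.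

(* A p-adic absolute value is not a
   [normedZmodType] norm (those satisfy [normrMn]), so it is kept as a bare
   function [abs : K -> R]. *)

Section ValuedField.
Variables (R : realType) (K : fieldType) (abs : K -> R).

Record ultrametric_absval : Prop := UltrametricAbsval {
  absval_ge0 : forall x, 0 <= abs x;
  absval_eq0 : forall x, abs x = 0 <-> x = 0;
  absvalM : forall x y, abs (x * y) = abs x * abs y;
  absvalD : forall x y, abs (x + y) <= Num.max (abs x) (abs y)
}.

Definition abs_cvg (u : nat -> K) (l : K) : Prop :=
  (fun n => abs (u n - l)) @ \oo --> (0 : R).

(* The limit for [abs], with the junk value 0 for divergent sequences. *)
Definition abs_lim (u : nat -> K) : K := xget 0 [set l | abs_cvg u l].

Definition abs_cauchy (u : nat -> K) : Prop :=
  forall e : R, 0 < e -> exists N : nat,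
    forall m n, (N <= m)%N -> (N <= n)%N -> abs (u m - u n) < e.

Definition abs_complete : Prop :=
  forall u, abs_cauchy u -> exists l, abs_cvg u l.

(* When K is complete of characteristic 0 and [abs] extends the p-adic absolute
   value, the closure of the prime field in K is the field Q_p. *)
Definition Qp : set K :=
  [set x | exists u : nat -> rat, abs_cvg (fun n => ratr (u n)) x].

Definition Qp_alg : set K :=
  [set x | exists P : {poly K}, [/\ P != 0, forall i, Qp P`_i & root P x]].

(* K, with [abs], is C_p: it is complete, and inside it the elements algebraic
   over Q_p form an algebraically closed field that is dense.  The normalization
   |p| = 1/p forces characteristic 0 and the p-adic absolute value on Q. *)
Record is_Cp (p : nat) : Prop := IsCp {
  Cp_absval : ultrametric_absval;
  Cp_norm_p : abs p%:R = p%:R^-1;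
  Cp_complete : abs_complete;
  Cp_alg_closed : forall P : {poly K}, (1 < size P)%N ->
    (forall i, Qp_alg P`_i) -> exists2 x, Qp_alg x & root P x;
  Cp_dense : forall x (e : R), 0 < e ->
    exists2 y, Qp_alg y & abs (x - y) < e
}.

Definition padic_exp (x : K) : K :=
  abs_lim (fun n => \sum_(i < n) x ^+ i / i`!%:R).

Definition padic_log (x : K) : K :=
  abs_lim (fun n => \sum_(i < n) (-1) ^+ i * (x - 1) ^+ i.+1 / i.+1%:R).

(* q^x = exp (x log q), meant for |x| <= 1 and |1 - q| < p^(-1/(p-1)). *)
Definition qpow (q x : K) : K := padic_exp (x * padic_log q).

(* [x]_q, with [x]_1 = x; in particular [2]_q = 1 + q *)
Definition qnum (q x : K) : K :=
  if q == 1 then x else (1 - qpow q x) / (1 - q).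

(* [m]_{-q}, for a natural number m *)
Definition qnum_neg (q : K) (m : nat) : K := (1 - (- q) ^+ m) / (1 + q).

(* The fermionic p-adic q-integral of f over Z_p.  Only the values of f on the
   natural numbers, which are dense in Z_p, enter; the limit exists when f is
   uniformly differentiable on Z_p. *)
Definition fermionic_integral (p : nat) (q : K) (f : K -> K) : K :=
  abs_lim (fun N => (qnum_neg q (p ^ N))^-1 *
    \sum_(x < p ^ N) (-1) ^+ x * f x%:R * qpow q x%:R).

(* The (h,q)-Genocchi polynomial G_{n,q}^{(h)}(x), normalized by
   G_{m+1,q}^{(h)}(x) / (m+1) = \int q^{(h-1)y} [x+y]_q^m dmu_{-q}(y). *)
Definition genocchi_poly (p h : nat) (q : K) (n : nat) (x : K) : K :=
  if n is m.+1 then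
    m.+1%:R * fermionic_integral p q
      (fun y => qpow q ((h%:R - 1) * y) * qnum q (x + y) ^+ m)
  else 0.

Definition genocchi (p h : nat) (q : K) (n : nat) : K :=
  genocchi_poly p h q n 0.

End ValuedField.

(* Main.v *)
Require Import Defs.
From HB Require Import structures.
From mathcomp Require Import all_boot all_order all_algebra.
From mathcomp Require Import all_classical all_reals all_analysis.
From mathcomp Require Import ring lra zify.

Import Order.TTheory GRing.Theory Num.Theory.

Local Open Scope ring_scope.

(** Write [[x]_q] for the [q]-number of [x] and let [L f] be the limit of the
    alternating sums of [(-1) ^+ x * f x] over [x < p ^ N].  As
    [q ^+ (p ^ N)] tends to 1, the fermionic [q]-integral of [f] is
    [(1 + q) / 2 * L (f * q ^ x)], so that the Genocchi number of index [m.+1]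
    divided by [m.+1] is [(1 + q) / 2 * L (q ^ (h * x) * [x]_q ^+ m)]
    ([genocchiE]).  By the binomial theorem the left-hand side of the identity
    is therefore [(1 + q) / 2] times
    [L (q ^ (h * x) * [x]_q ^+ k * (1 - [x]_q) ^+ (n - k))], and expanding
    [[x]_q ^+ k = (1 - (1 - [x]_q)) ^+ k] turns this into a combination of the
    values of [L] at [q ^ (h * x) * (1 - [x]_q) ^+ (n - l)].  Since
    [1 - [x]_q = [1 - x]_{q^-1}], it remains to reflect [x] into [1 - x]:
    reversing the order of summation in the alternating sums gives
    [L (f (1 - x)) = L f + 2 * (f 1 - f 0)] ([altlim_reflect]).  The boundary
    term yields [1 + q] and the main term the Genocchi number at [q^-1].

    The limit [L f] exists whenever [f] is uniformly continuous for the
    [p]-adic topology on the integers ([altlim_cvg]).  Reflection involves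
    negative arguments, so [f] is taken on [int], where [q ^ x] is an integral
    power.  In [genocchiE], [q ^ x] is replaced by an honest power: [exp (m * log q) = q ^+ m] for natural [m]
    ([qpow_natr]), and the sums that define the integral involve only natural
    exponents.

    That fact rests on the additivity of [exp] and on [exp (log q) = q].  The
    latter is proved without composing power series ([padic_exp_log]): both
    [q] and [exp (log q)] have [p ^ N]-th power
    [1 + p ^ N * log q + o(p ^ N)], and raising to the power [p] contracts the
    distance to 1 by exactly [p^-1] in the disc of convergence of [exp], so
    their ratio, a fixed element of that disc, must be 1. *)

(** * Ultrametric absolute values and convergence *)

Section Ultrametric.
Set Implicit Arguments.
Unset Strict Implicit.
Variables (R : realType) (K : fieldType) (abs : K -> R).
Hypothesis Habs : ultrametric_absval abs.

Let abs_ge0 := absval_ge0 Habs.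
Let absM := absvalM Habs.

Lemma abs0 : abs 0 = 0.
Proof. by apply/(absval_eq0 Habs). Qed.

Lemma abs_neq0 x : x != 0 -> abs x != 0.
Proof. by apply: contraNN => /eqP /(absval_eq0 Habs) ->. Qed.

Lemma abs_gt0 x : x != 0 -> 0 < abs x.
Proof. by move=> x0; rewrite lt_def abs_neq0 ?abs_ge0. Qed.

Lemma abs1 : abs 1 = 1.
Proof.
apply: (mulfI (abs_neq0 (oner_neq0 K))).
by rewrite -absM !mulr1.
Qed.

Lemma absX x n : abs (x ^+ n) = abs x ^+ n.
Proof. by elim: n => [|n IH]; rewrite ?expr0 ?abs1 // !exprS absM IH. Qed.

Lemma absN x : abs (- x) = abs x.
Proof.
have absN1 : abs (-1) = 1.
  apply/eqP; rewrite -(@eqrXn2 _ 2) ?abs_ge0 //.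
  by rewrite -absX sqrrN !expr1n abs1.
by rewrite -mulN1r absM absN1 mul1r.
Qed.

Lemma abs_sign n x : abs ((-1) ^+ n * x) = abs x.
Proof. by rewrite absM absX absN abs1 expr1n mul1r. Qed.

Lemma absBC x y : abs (x - y) = abs (y - x).
Proof. by rewrite -absN opprB. Qed.

Lemma absV x : abs x^-1 = (abs x)^-1.
Proof.
have [->|x0] := eqVneq x 0; first by rewrite invr0 abs0 invr0.
apply: (mulfI (abs_neq0 x0)).
by rewrite -absM divff // abs1 divff // abs_neq0.
Qed.

Lemma absD_le x y B : abs x <= B -> abs y <= B -> abs (x + y) <= B.
Proof.
by move=> xB yB; apply: le_trans (absvalD Habs _ _) _; rewrite ge_max xB yB.
Qed.

Lemma absB_le x y B : abs x <= B -> abs y <= B -> abs (x - y) <= B.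
Proof. by move=> xB yB; apply: absD_le => //; rewrite absN. Qed.

Lemma absM_le1 x y B : abs x <= 1 -> abs y <= B -> abs (x * y) <= B.
Proof.
move=> x1 yB; rewrite absM; apply: le_trans yB.
exact: ler_piMl.
Qed.

Lemma abs_sum_le (I : Type) (r : seq I) (P : pred I) (F : I -> K) B :
  0 <= B -> (forall i, P i -> abs (F i) <= B) ->
  abs (\sum_(i <- r | P i) F i) <= B.
Proof.
move=> B0 FB; elim/big_rec: _ => [|i x Pi xB]; first by rewrite abs0.
by apply: absD_le => //; apply: FB.
Qed.

Lemma abs_nat_le1 n : abs n%:R <= 1.
Proof.
elim: n => [|n IH]; first by rewrite abs0 ler01.
by rewrite -addn1 natrD absD_le ?abs1.
Qed.

Lemma abs_int_le1 (n : int) : abs n%:~R <= 1.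
Proof.
case: n => n; first exact: abs_nat_le1.
by rewrite NegzE mulrNz absN; apply: (abs_nat_le1 n.+1).
Qed.

(** The isosceles triangle principle. *)
Lemma abs_dominant x y : abs y < abs x -> abs (x + y) = abs x.
Proof.
move=> yx; apply/le_anti/andP; split; first exact: absD_le (ltW yx).
rewrite leNgt; apply/negP => lt_xy.
have := absvalD Habs (x + y) (- y); rewrite addrK absN leNgt gt_max.
by rewrite lt_xy yx.
Qed.

Lemma abs_near1 x : abs (1 - x) < 1 -> abs x = 1.
Proof.
by move=> h; rewrite -[x](subKr 1) abs_dominant ?abs1 ?absN.
Qed.

Lemma abs_cvgP u l : abs_cvg abs u l <->
  forall e : R, 0 < e -> exists N, forall n, (N <= n)%N -> abs (u n - l) <= e.
Proof.
split.
  move=> /cvgr0Pnorm_le H e e0; have [N _ HN] := H e e0.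
  by exists N => n Nn; have := HN n Nn; rewrite /= ger0_norm.
move=> H; apply/cvgr0Pnorm_le => e e0; have [N HN] := H e e0.
by exists N => // n Nn; rewrite /= ger0_norm //; apply: HN.
Qed.

Lemma abs_cvg_eventually_eq u v l N :
  (forall n, (N <= n)%N -> u n = v n) -> abs_cvg abs u l -> abs_cvg abs v l.
Proof.
move=> uv /abs_cvgP ul; apply/abs_cvgP => e /ul [M HM].
exists (maxn M N) => n; rewrite geq_max => /andP[Mn Nn].
by rewrite -uv //; apply: HM.
Qed.

Lemma eq_abs_cvg u v l : u =1 v -> abs_cvg abs u l -> abs_cvg abs v l.
Proof. by move=> uv; apply: (@abs_cvg_eventually_eq _ _ _ 0) => n _. Qed.

Lemma abs_cvg_cst c : abs_cvg abs (fun=> c) c.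
Proof.
by apply/abs_cvgP => e e0; exists 0%N => n _; rewrite subrr abs0 ltW.
Qed.

Lemma abs_cvgD u v a b : abs_cvg abs u a -> abs_cvg abs v b ->
  abs_cvg abs (fun n => u n + v n) (a + b).
Proof.
move=> /abs_cvgP ua /abs_cvgP vb; apply/abs_cvgP => e e0.
have [M HM] := ua e e0; have [N HN] := vb e e0.
exists (maxn M N) => n; rewrite geq_max => /andP[Mn Nn].
by rewrite opprD addrACA absD_le ?HM ?HN.
Qed.

Lemma abs_cvg_sum (I : Type) (r : seq I) (u : I -> nat -> K) (a : I -> K) :
  (forall i, abs_cvg abs (u i) (a i)) ->
  abs_cvg abs (fun n => \sum_(i <- r) u i n) (\sum_(i <- r) a i).
Proof.
move=> ua; elim: r => [|i r IH].
  apply: (@eq_abs_cvg (fun=> 0)) => [n|]; rewrite big_nil //.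
  exact: abs_cvg_cst.
apply: (@eq_abs_cvg (fun n => u i n + \sum_(j <- r) u j n)) => [n|].
  by rewrite big_cons.
by rewrite big_cons; apply: abs_cvgD.
Qed.

Lemma abs_cvg0_bounded u v B : (forall n, abs (v n) <= B) ->
  abs_cvg abs u 0 -> abs_cvg abs (fun n => v n * u n) 0.
Proof.
move=> vB /abs_cvgP u0; apply/abs_cvgP => e e0.
have B0 : 0 <= B by exact: le_trans (vB 0%N).
have B1 : 0 < B + 1 by rewrite ltr_wpDl.
have [N HN] := u0 (e / (B + 1)) (divr_gt0 e0 B1).
exists N => n /HN; rewrite !subr0 absM => une.
apply: le_trans (ler_pM _ _ (vB n) une) _ => //.
by rewrite mulrCA ler_piMr ?ltW // ltr_pdivrMr // mul1r ltrDl.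
Qed.

Lemma abs_cvgZ c u l : abs_cvg abs u l -> abs_cvg abs (fun n => c * u n) (c * l).
Proof.
move=> /abs_cvgP ul.
have d0 : abs_cvg abs (fun n => u n - l) 0.
  by apply/abs_cvgP => e /ul [N HN]; exists N => n /HN; rewrite subr0.
have := @abs_cvg0_bounded _ (fun=> c) (abs c) (fun=> lexx _) d0.
move=> /abs_cvgD /(_ (abs_cvg_cst (c * l))); rewrite add0r.
by apply: eq_abs_cvg => n; rewrite mulrBr subrK.
Qed.

Lemma abs_cvg_bounded u l : abs_cvg abs u l ->
  exists N B, forall n, (N <= n)%N -> abs (u n) <= B.
Proof.
move=> /abs_cvgP /(_ 1 ltr01) [N HN].
exists N, (Num.max 1 (abs l)) => n /HN ul.
rewrite -[u n](subrK l); apply: absD_le; rewrite le_max ?ul ?lexx //.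
by rewrite orbT.
Qed.

Lemma abs_cvgM u v a b : abs_cvg abs u a -> abs_cvg abs v b ->
  abs_cvg abs (fun n => u n * v n) (a * b).
Proof.
move=> ua vb.
have u'0 : abs_cvg abs (fun n => u n - a) 0.
  by rewrite -(subrr a); apply: abs_cvgD ua (abs_cvg_cst _).
have [N [B HB]] := abs_cvg_bounded vb.
(* [v] is only known to be bounded from rank [N] on. *)
pose w n := if (N <= n)%N then v n else 0.
have wB n : abs (w n) <= Num.max B 0.
  rewrite /w le_max; case: ifP => [/HB -> //|_].
  by rewrite abs0 lexx orbT.
have := abs_cvgD (abs_cvg0_bounded wB u'0) (abs_cvgZ a vb).
rewrite add0r; apply: (@abs_cvg_eventually_eq _ _ _ N) => n Nn.
by rewrite /w Nn mulrBr mulrC [v n * a]mulrC subrK.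
Qed.

Lemma abs_cvg_unique u a b : abs_cvg abs u a -> abs_cvg abs u b -> a = b.
Proof.
move=> /abs_cvgP ua /abs_cvgP ub; apply/eqP; rewrite -subr_eq0.
apply/negPn/negP => /abs_gt0 d0.
have e0 : 0 < abs (a - b) / 2 by rewrite divr_gt0.
have [M HM] := ua _ e0; have [N HN] := ub _ e0.
have := @absB_le (u (M + N)%N - b) (u (M + N)%N - a) _
  (HN _ (leq_addl _ _)) (HM _ (leq_addr _ _)).
have -> : u (M + N)%N - b - (u (M + N)%N - a) = a - b by ring.
by rewrite leNgt ltr_pdivrMr // ltr_pMr // ltr1n.
Qed.

Lemma abs_limE u l : abs_cvg abs u l -> abs_lim abs u = l.
Proof.
by move=> ul; apply: xget_unique => [//|m um]; apply: abs_cvg_unique um ul.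
Qed.

Lemma abs_cvg_le u l B N : abs_cvg abs u l ->
  (forall n, (N <= n)%N -> abs (u n) <= B) -> abs l <= B.
Proof.
move=> /abs_cvgP ul uB; apply/ler_addgt0Pr => e e0.
have [M HM] := ul e e0.
have B0 : 0 <= B by apply: le_trans (uB N _).
rewrite -[l](subKr (u (M + N)%N)); apply: absB_le.
  by apply: le_trans (uB _ (leq_addl _ _)) _; rewrite lerDl ltW.
by apply: le_trans (HM _ (leq_addr _ _)) _; rewrite lerDr.
Qed.

(** In an ultrametric space a sequence is Cauchy as soon as its consecutive
    differences tend to 0, since the absolute value of a sum of such
    differences is at most the largest of their absolute values. *)
Lemma abs_cvg_of_steps u : abs_complete abs ->
  abs_cvg abs (fun n => u n.+1 - u n) 0 -> abs_cvg abs u (abs_lim abs u).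
Proof.
move=> Kc /abs_cvgP du.
suff [l ul] : exists l, abs_cvg abs u l by rewrite (abs_limE ul).
apply: Kc => e e0; have [N HN] := du (e / 2) (divr_gt0 e0 (ltr0Sn _ _)).
have far n : (N <= n)%N -> abs (u n - u N) <= e / 2.
  move=> /subnK <-; elim: (n - N)%N => [|k IH].
    by rewrite add0n subrr abs0 divr_ge0 // ltW.
  rewrite addSn -(subrK (u (k + N)%N) (u (k + N).+1)) -addrA.
  by apply: absD_le IH; have := HN _ (leq_addl k N); rewrite subr0.
exists N => m n Nm Nn; apply: (@le_lt_trans _ _ (e / 2)); last first.
  by rewrite ltr_pdivrMr // ltr_pMr // ltr1n.
have -> : u m - u n = (u m - u N) - (u n - u N) by ring.
by apply: absB_le; apply: far.
Qed.

Lemma geometric_eventually_le (s B : R) : 0 <= s -> s < 1 ->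
  forall e : R, 0 < e -> exists N, forall n, (N <= n)%N -> B * s ^+ n <= e.
Proof.
move=> s0 s1 e e0.
have : `|s| < 1 by rewrite ger0_norm.
move=> /cvg_expr /cvgr0Pnorm_le H.
have B1 : 0 < `|B| + 1 by rewrite ltr_wpDl.
have [N _ HN] := H _ (divr_gt0 e0 B1).
exists N => n /HN /=; rewrite ger0_norm ?exprn_ge0 // => sn.
apply: le_trans (ler_wpM2r (exprn_ge0 n s0) (ler_norm B)) _.
apply: le_trans (ler_wpM2l (normr_ge0 B) sn) _.
by rewrite mulrCA ler_piMr ?ltW // ltr_pdivrMr // mul1r ltrDl.
Qed.

Lemma abs_cvg0_geometric u (s B : R) : 0 <= s -> s < 1 ->
  (forall n, abs (u n) <= B * s ^+ n) -> abs_cvg abs u 0.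
Proof.
move=> s0 s1 uB; apply/abs_cvgP => e e0.
have [N HN] := geometric_eventually_le B s0 s1 e0.
by exists N => n /HN sn; rewrite subr0; apply: le_trans (uB n) sn.
Qed.

Lemma abs_cvg_subseq u l (f : nat -> nat) : (forall n, (n <= f n)%N) ->
  abs_cvg abs u l -> abs_cvg abs (fun n => u (f n)) l.
Proof.
move=> nf /abs_cvgP ul; apply/abs_cvgP => e /ul [N HN].
by exists N => n Nn; apply: HN; apply: leq_trans Nn (nf n).
Qed.

(** Dominated convergence for sums of a varying number of terms. *)
Lemma abs_cvg0_sum (F : nat -> nat -> K) (M : nat -> nat) (s B : R) :
  0 <= s -> s < 1 -> (forall n i, abs (F n i) <= B * s ^+ i) ->
  (forall i, abs_cvg abs (F^~ i) 0) ->
  abs_cvg abs (fun n => \sum_(i < M n) F n i) 0.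
Proof.
move=> s0 s1 FB F0; apply/abs_cvgP => e e0.
have [I HI] := geometric_eventually_le B s0 s1 e0.
have [N HN] : exists N, forall n i, (N <= n)%N -> (i < I)%N -> abs (F n i) <= e.
  elim: (I) => [|J [N HN]]; first by exists 0%N.
  have /abs_cvgP /(_ e e0) [N' HN'] := F0 J.
  exists (maxn N N') => n i; rewrite geq_max => /andP[Nn N'n].
  rewrite ltnS leq_eqVlt => /predU1P[->|]; last exact: HN.
  by have := HN' _ N'n; rewrite subr0.
exists N => n Nn; rewrite subr0; apply: abs_sum_le (ltW e0) _ => i _.
have [iI|Ii] := ltnP i I; first exact: HN.
exact: le_trans (FB n i) (HI i Ii).
Qed.

End Ultrametric.

(** * The p-adic exponential and logarithm *)

Section Padic.
Set Implicit Arguments.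
Unset Strict Implicit.
Variables (R : realType) (p : nat) (K : fieldType) (abs : K -> R).
Hypothesis p_prime : prime p.
Hypothesis Habs : ultrametric_absval abs.
Hypothesis norm_p : abs p%:R = p%:R^-1.

Let abs_ge0 := absval_ge0 Habs.
Let absM := absvalM Habs.
Let abs0 := abs0 Habs.
Let abs1 := abs1 Habs.
Let absX := absX Habs.
Let absN := absN Habs.
Let absV := absV Habs.
Let abs_sign := abs_sign Habs.
Let abs_dominant := abs_dominant Habs.
Let absBC := absBC Habs.
Let abs_nat_le1 := abs_nat_le1 Habs.
Let abs_gt0 := abs_gt0 Habs.
Let p_gt0 : (0 < p)%N := prime_gt0 p_prime.
Let p_gt1 : (1 < p)%N := prime_gt1 p_prime.

Lemma invp_gt0 : 0 < p%:R^-1 :> R.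
Proof. by rewrite invr_gt0 ltr0n. Qed.

Lemma invp_lt1 : p%:R^-1 < 1 :> R.
Proof. by rewrite invf_lt1 ?ltr1n ?ltr0n. Qed.

(** A Bezout relation [u * m = v * p + 1] forces [abs m = 1], because
    [v * p] has absolute value less than 1. *)
Lemma abs_coprime m : coprime p m -> abs m%:R = 1.
Proof.
move=> pm; apply/le_anti; rewrite abs_nat_le1 //= leNgt; apply/negP => m1.
have m_gt0 : (0 < m)%N.
  by case: m pm m1 => // pm _; move: pm; rewrite /coprime gcdn0 gtn_eqF.
have [u v Hv _] := egcdnP p m_gt0.
rewrite gcdnC (eqP pm) in Hv.
suff : abs 1 < 1 by rewrite abs1 // ltxx.
have -> : 1 = u%:R * m%:R - v%:R * p%:R :> K.
  by rewrite -!natrM Hv natrD addrAC subrr add0r.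
apply: le_lt_trans (absvalD Habs _ _) _.
rewrite gt_max absN // !absM norm_p.
rewrite (le_lt_trans (ler_piMl _ (abs_nat_le1 u)) m1) //.
apply: le_lt_trans (ler_piMl _ (abs_nat_le1 v)) invp_lt1.
by rewrite ltW ?invp_gt0.
Qed.

Lemma abs_natr n : (0 < n)%N -> abs n%:R = p%:R^-1 ^+ logn p n.
Proof.
move=> n0; have [m pm {1}->] := pfactor_coprime p_prime n0.
by rewrite natrM absM abs_coprime // mul1r natrX absX // norm_p.
Qed.

Lemma natr_neq0 n : (0 < n)%N -> n%:R != 0 :> K.
Proof.
move=> n0; apply/eqP => n_eq0; have := abs_natr n0.
rewrite n_eq0 abs0 // => /esym/eqP; rewrite expf_eq0 => /andP[_].
by rewrite gt_eqF ?invp_gt0.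
Qed.

(** Legendre's bound: as [p * (n %/ p ^ k.+1) <= n %/ p ^ k], the sum of the
    [n %/ p ^ k], multiplied by [p - 1], telescopes; the last nonzero
    quotient, which is at least 1, accounts for the difference between [n.+1]
    and [n]. *)
Lemma logn_fact_le n : (p.-1 * logn p n.+1`! <= n)%N.
Proof.
(* [maxn 1 _] keeps the 1 to be saved once the quotients vanish. *)
suff H k : (p.-1 * \sum_(1 <= i < k.+1) n.+1 %/ p ^ i
            + maxn 1 (n.+1 %/ p ^ k) <= n.+1)%N.
  have := H n.+1; rewrite logn_fact //; lia.
elim: k => [|k IH]; first by rewrite big_geq // muln0 expn0 divn1; lia.
rewrite big_nat_recr //= mulnDr.
have := leq_trunc_div (n.+1 %/ p ^ k) p; rewrite -divnMA -expnSr.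
move: IH; set S := (p.-1 * _)%N; set a := (_ %/ p ^ k)%N.
set b := (_ %/ _)%N; case: (posnP b) => [->|b0]; first by lia.
by have -> : (b * p = p.-1 * b + b)%N; nia.
Qed.

Local Notation rho := (p%:R `^ (- (p%:R - 1)^-1) : R).

Lemma rho_gt0 : 0 < rho.
Proof. by rewrite powR_gt0 // ltr0n. Qed.

Lemma rho_exp : rho ^+ p.-1 = p%:R^-1.
Proof.
rewrite -powR_mulrn ?powR_ge0 // -powRrM -[RHS]powR_inv1 ?ler0n //.
congr (_ `^ _); rewrite mulNr; congr (- _).
have -> : p.-1%:R = p%:R - 1 :> R by rewrite -subn1 natrB.
by rewrite mulVf // subr_eq0 pnatr_eq1 gtn_eqF.
Qed.

Lemma rho_lt1 : rho < 1.
Proof.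
rewrite -(@expr_lt1 _ p.-1); first by rewrite rho_exp invp_lt1.
- by rewrite -ltnS prednK.
- exact: ltW rho_gt0.
Qed.

Lemma abs_fact_ge n : rho ^+ n <= abs n.+1`!%:R.
Proof.
rewrite abs_natr ?fact_gt0 // -rho_exp -exprM.
by apply: ler_wiXn2l (logn_fact_le n); rewrite ltW ?rho_gt0 ?rho_lt1.
Qed.

Lemma natr_fact_neq0 n : n`!%:R != 0 :> K.
Proof. by rewrite natr_neq0 ?fact_gt0. Qed.

(** [rho] is the radius of convergence of [exp].  Keeping the factor [abs x]
    apart, instead of [rho], makes [log] and [exp - 1] map the disc of radius
    [rho] into itself, so that [exp (log q)] makes sense. *)
Lemma exp_term_le x n :
  abs (x ^+ n.+1 / n.+1`!%:R) <= abs x * (abs x / rho) ^+ n.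
Proof.
rewrite absM absV // absX // exprS expr_div_n mulrA.
apply: ler_wpM2l; first by rewrite mulr_ge0 ?exprn_ge0.
rewrite lef_pV2 ?abs_fact_ge ?posrE ?exprn_gt0 ?rho_gt0 //.
by rewrite abs_gt0 // natr_fact_neq0.
Qed.

Lemma log_term_le x n :
  abs (x ^+ n.+1 / n.+1%:R) <= abs x * (abs x / rho) ^+ n.
Proof.
apply: le_trans (exp_term_le x n).
rewrite factS natrM invfM mulrA [in leRHS]absM [abs n`!%:R^-1]absV //.
rewrite ler_peMr ?mulr_ge0 ?invr_ge0 // invf_ge1 ?abs_nat_le1 //.
by rewrite abs_gt0 // natr_fact_neq0.
Qed.

Lemma abs_bin_prime_le i : (0 < i < p)%N -> abs 'C(p, i)%:R <= p%:R^-1.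
Proof.
move=> ip; have /dvdnP[m ->] := prime_dvd_bin p_prime ip.
by rewrite natrM absM_le1 ?abs_nat_le1 // norm_p.
Qed.

Lemma exprB1_bin (q : K) n :
  q ^+ n - 1 = \sum_(i < n) 'C(n, i.+1)%:R * (q - 1) ^+ i.+1.
Proof.
rewrite -{1}(subrK 1 q) [_ - 1 + 1]addrC exprDn big_ord_recl /=.
rewrite expr1n mul1r expr0 bin0 mulr1n [1 + _]addrC addrK.
by apply: eq_bigr => i _; rewrite expr1n mul1r mulr_natl.
Qed.

(** In the binomial expansion of [q ^+ p - 1] the linear term [p * (q - 1)]
    dominates: the middle binomial coefficients are divisible by [p], and
    [abs (q - 1) ^+ p.-1 < p^-1] by the choice of [rho]. *)
Lemma abs_exprpB1 q : abs (q - 1) < rho ->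
  abs (q ^+ p - 1) = p%:R^-1 * abs (q - 1).
Proof.
move=> q_near1; rewrite exprB1_bin.
have [->|q1] := eqVneq (q - 1) 0.
  by rewrite big1 ?abs0 ?mulr0 // => i _; rewrite expr0n mulr0.
have t0 := abs_gt0 q1; set t := q - 1 in t0 q_near1 *.
have tp : abs t ^+ p.-1 < p%:R^-1.
  by rewrite -rho_exp ltrXn2r ?nnegrE ?(ltW rho_gt0) //; rewrite -lt0n -ltnS prednK.
rewrite -(big_mkord xpredT (fun i => 'C(p, i.+1)%:R * t ^+ i.+1)).
rewrite big_ltn // big_add1 big_mkord expr1 bin1.
rewrite abs_dominant // absM norm_p //.
(* The first argument of [B] bounds the terms of degree [1 < i < p], the
   second that of degree [p]. *)
pose B := Num.max (p%:R^-1 * abs t ^+ 2) (abs t ^+ p.-1 * abs t).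
apply: (@le_lt_trans _ _ B); last first.
  rewrite gt_max expr2 mulrA !ltr_pM2r // tp andbT.
  by rewrite gtr_pMr ?invp_gt0 // (lt_trans q_near1 rho_lt1).
apply: abs_sum_le => // [|i _].
  by rewrite le_max !mulr_ge0 ?exprn_ge0 ?(ltW invp_gt0).
rewrite absM absX le_max; apply/orP.
have [ip|pi] := ltnP i.+2 p; [left|right].
  apply: ler_pM; rewrite ?exprn_ge0 // ?abs_bin_prime_le //.
  by rewrite ler_wiXn2l // ltW // (lt_trans q_near1 rho_lt1).
rewrite -exprSr prednK //.
have -> : i.+2 = p by apply/eqP; rewrite eqn_leq pi andbT; have := ltn_ord i; lia.
by rewrite binn abs1 // mul1r.
Qed.

Lemma abs_exprpXB1 q n : abs (q - 1) < rho ->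
  abs (q ^+ (p ^ n) - 1) = p%:R^-1 ^+ n * abs (q - 1).
Proof.
move=> q_near1; elim: n => [|n IH]; first by rewrite expr0 mul1r.
rewrite expnSr exprM abs_exprpB1 IH ?mulrA -?exprS //.
apply: le_lt_trans q_near1; rewrite ler_piMl //.
by rewrite exprn_ile1 // ltW ?invp_gt0 ?invp_lt1.
Qed.

Hypothesis Kc : abs_complete abs.

Lemma ratio_bounds x : abs x < rho -> 0 <= abs x / rho < 1.
Proof.
move=> xr; rewrite divr_ge0 ?(ltW rho_gt0) //=.
by rewrite ltr_pdivrMr ?rho_gt0 // mul1r.
Qed.

Definition exp_sum (x : K) n := \sum_(i < n) x ^+ i / i`!%:R.

Lemma exp_coef_le x n : abs x < rho ->
  abs (x ^+ n / n`!%:R) <= (abs x / rho) ^+ n.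
Proof.
case: n => [_|n xr]; first by rewrite expr0 divr1 abs1.
apply: le_trans (exp_term_le x n) _; rewrite exprS ler_wpM2r //.
  by rewrite exprn_ge0 //; have /andP[] := ratio_bounds xr.
by rewrite ler_pdivlMr ?rho_gt0 // ler_piMr // ltW ?rho_lt1.
Qed.

Lemma padic_exp_cvg x : abs x < rho ->
  abs_cvg abs (exp_sum x) (padic_exp abs x).
Proof.
move=> xr; have /andP[s0 s1] := ratio_bounds xr.
apply: abs_cvg_of_steps => //.
apply: (abs_cvg0_geometric Habs s0 s1 (B := 1)) => n.
by rewrite /exp_sum big_ord_recr /= addrAC subrr add0r mul1r exp_coef_le.
Qed.

(** The linear approximation of [exp] at 0: on the disc the quadratic and
    higher terms are all bounded by the bound for the quadratic one. *)
Lemma padic_exp_near x : abs x < rho ->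
  abs (padic_exp abs x - 1 - x) <= abs x * (abs x / rho).
Proof.
move=> xr; have /andP[s0 s1] := ratio_bounds xr.
have := abs_cvgD Habs (padic_exp_cvg xr) (abs_cvg_cst Habs (- 1 - x)).
rewrite addrA => /(abs_cvg_le Habs (N := 2)); apply => n.
case: n => [|[|n]] // _.
rewrite /exp_sum !big_ord_recl /= expr0 expr1 !divr1.
have -> a : 1 + (x + a) + (-1 - x) = a by ring.
apply: abs_sum_le => // [|i _]; first by rewrite mulr_ge0.
rewrite /bump !add1n; apply: le_trans (exp_term_le _ _) _.
by rewrite ler_wpM2l // exprS ler_piMr // exprn_ile1 // ltW.
Qed.

Lemma abs_padic_expB1 x : abs x < rho -> abs (padic_exp abs x - 1) <= abs x.
Proof.
move=> xr; have /andP[s0 s1] := ratio_bounds xr.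
rewrite -[_ - 1](subrK x) absD_le //.
by apply: le_trans (padic_exp_near xr) _; rewrite ler_piMr // ltW.
Qed.

Lemma sum_convolution (a b : nat -> K) n :
  \sum_(k < n) \sum_(i < k.+1) a i * b (k - i)%N =
  \sum_(i < n) a i * \sum_(j < n - i) b j.
Proof.
elim: n => [|n IH]; first by rewrite !big_ord0.
rewrite big_ord_recr /= IH [RHS]big_ord_recr /= subSn // subnn.
rewrite big_ord_recr /= subnn big_ord1 addrA -big_split /=; congr (_ + _).
apply: eq_bigr => i _; rewrite -mulrDr subSn ?big_ord_recr //.
exact: ltnW.
Qed.

Lemma exp_sumD x y n :
  exp_sum (x + y) n =
  \sum_(i < n) x ^+ i / i`!%:R * exp_sum y (n - i).
Proof.
rewrite -(sum_convolution (fun i => x ^+ i / i`!%:R) (fun j => y ^+ j / j`!%:R)).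
apply: eq_bigr => k _; rewrite [x + y]addrC exprDn mulr_suml.
apply: eq_bigr => i _; have ik : (i <= k)%N by rewrite -ltnS.
rewrite -(bin_fact ik) -mulr_natl !natrM.
have := natr_neq0; set c := 'C(k, i)%:R => _.
have c0 : c != 0 by rewrite natr_neq0 // bin_gt0.
by field; rewrite c0 !natr_fact_neq0.
Qed.

(** In the product of two partial sums of the exponential series, the terms
    that are missing from the partial sum at [x + y] have total degree at
    least [n], so they tend to 0 uniformly. *)
Lemma padic_expD x y : abs x < rho -> abs y < rho ->
  padic_exp abs (x + y) = padic_exp abs x * padic_exp abs y.
Proof.
wlog yx : x y / abs y <= abs x => [H xr yr|xr yr].
  have [/H->//|/ltW/H yx] := leP (abs y) (abs x).
  by rewrite addrC [RHS]mulrC yx.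
have xyr : abs (x + y) < rho.
  by apply: le_lt_trans (absvalD Habs _ _) _; rewrite gt_max xr yr.
have /andP[s0 s1] := ratio_bounds xr.
have yxs : abs y / rho <= abs x / rho by rewrite ler_pM2r // invr_gt0 rho_gt0.
have := abs_cvgM Habs (padic_exp_cvg xr) (padic_exp_cvg yr).
apply: (abs_cvg_unique Habs).
have D0 : abs_cvg abs (fun n => exp_sum x n * exp_sum y n - exp_sum (x + y) n) 0.
  apply: (abs_cvg0_geometric Habs s0 s1 (B := 1)) => n.
  rewrite exp_sumD mulr_suml -sumrB mul1r.
  apply: abs_sum_le => // [|[i /= /ltnW i_n] _]; first by rewrite exprn_ge0.
  rewrite -mulrBr absM -[leRHS](congr1 (GRing.exp _) (subnKC i_n)) exprD.
  apply: ler_pM => //; first exact: exp_coef_le.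
  rewrite /exp_sum -!(big_mkord xpredT (fun j => y ^+ j / j`!%:R)).
  rewrite (@big_cat_nat _ _ _ (n - i)) ?leq_subr //= addrAC subrr add0r.
  rewrite big_nat_cond; apply: abs_sum_le => // [|j]; first by rewrite exprn_ge0.
  rewrite andbT => /andP[nij _]; apply: le_trans (exp_coef_le j yr) _.
  apply: (@le_trans _ _ ((abs x / rho) ^+ j)).
    by rewrite lerXn2r // nnegrE divr_ge0 // ltW ?rho_gt0.
  by rewrite ler_wiXn2l // ltW.
have := abs_cvgD Habs D0 (padic_exp_cvg xyr); rewrite add0r.
by apply: (eq_abs_cvg Habs) => n; rewrite subrK.
Qed.

Lemma padic_exp0 : padic_exp abs 0 = 1.
Proof.
apply: abs_limE => //; apply: (abs_cvg_eventually_eq Habs (u := fun=> 1) (N := 1)).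
  case=> // n _; rewrite big_ord_recl expr0 divr1 big1 ?addr0 // => i _.
  by rewrite expr0n mul0r.
exact: abs_cvg_cst.
Qed.

Lemma padic_expMn x m : abs x < rho ->
  padic_exp abs (m%:R * x) = padic_exp abs x ^+ m.
Proof.
move=> xr; elim: m => [|m IH]; first by rewrite mul0r padic_exp0.
rewrite -addn1 natrD mulrDl mul1r padic_expD ?IH ?exprD //.
by apply: le_lt_trans xr; rewrite absM_le1 ?abs_nat_le1.
Qed.

Definition log_sum (q : K) n :=
  \sum_(i < n) (-1) ^+ i * (q - 1) ^+ i.+1 / i.+1%:R.

Lemma log_coef_le q n : abs ((-1) ^+ n * (q - 1) ^+ n.+1 / n.+1%:R) <=
  abs (q - 1) * (abs (q - 1) / rho) ^+ n.
Proof. by rewrite -mulrA abs_sign ?log_term_le. Qed.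

Lemma padic_log_cvg q : abs (q - 1) < rho ->
  abs_cvg abs (log_sum q) (padic_log abs q).
Proof.
move=> qr; have /andP[s0 s1] := ratio_bounds qr.
apply: abs_cvg_of_steps => //.
apply: (abs_cvg0_geometric Habs s0 s1 (B := abs (q - 1))) => n.
by rewrite /log_sum big_ord_recr /= addrAC subrr add0r log_coef_le.
Qed.

Lemma abs_padic_log q : abs (q - 1) < rho ->
  abs (padic_log abs q) <= abs (q - 1).
Proof.
move=> qr; have /andP[s0 s1] := ratio_bounds qr.
apply: (abs_cvg_le Habs (N := 0) (padic_log_cvg qr)) => n _.
apply: abs_sum_le => // i _; apply: le_trans (log_coef_le q i) _.
by rewrite ler_piMr // exprn_ile1 // ltW.
Qed.

(** By Pascal's rule the errors at [i] and [i.+1] differ in sign up to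
    ['C(p ^ n, i.+1) = p ^ n / i.+1 * 'C((p ^ n).-1, i)], which is small. *)
Lemma bin_predp_near n i :
  abs ('C((p ^ n).-1, i)%:R - (-1) ^+ i) <= p%:R^-1 ^+ n / abs i`!%:R.
Proof.
have pn0 : (0 < p ^ n)%N by rewrite expn_gt0 p_gt0.
elim: i => [|i IH].
  by rewrite bin0 expr0 subrr abs0 // divr_ge0 // exprn_ge0 // ltW ?invp_gt0.
have -> : 'C((p ^ n).-1, i.+1)%:R - (-1) ^+ i.+1 =
    'C(p ^ n, i.+1)%:R - ('C((p ^ n).-1, i)%:R - (-1) ^+ i) :> K.
  by rewrite -{2}(prednK pn0) binS natrD exprS; ring.
have le_fact : (abs i`!%:R)^-1 <= (abs i.+1`!%:R)^-1.
  rewrite lef_pV2 ?posrE ?abs_gt0 ?natr_fact_neq0 //.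
  by rewrite factS natrM absM_le1 ?abs_nat_le1.
have pn_ge0 : 0 <= p%:R^-1 ^+ n :> R by rewrite exprn_ge0 // ltW ?invp_gt0.
apply: absB_le => //; last by apply: le_trans IH _; rewrite ler_wpM2l.
have -> : 'C(p ^ n, i.+1)%:R =
    (p ^ n)%:R * ('C((p ^ n).-1, i)%:R * i`!%:R) / i.+1`!%:R :> K.
  apply: (canRL (mulfK (natr_fact_neq0 _))).
  by rewrite -!natrM factS [in LHS]mulnA [in LHS](mulnC 'C(_, _)) -mul_bin_diag mulnA.
rewrite absM absV // ler_wpM2r ?invr_ge0 // absM // natrX absX // norm_p.
by rewrite ler_piMr // absM_le1 ?abs_nat_le1.
Qed.

(** [log q] is the derivative of [q ^ x] at [x = 0]: the coefficient
    ['C(p ^ n, i.+1) / p ^ n] of the binomial expansion equals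
    ['C((p ^ n).-1, i) / i.+1], which tends to [(-1) ^+ i / i.+1]. *)
Lemma padic_log_limit q : abs (q - 1) < rho ->
  abs_cvg abs (fun n => (q ^+ (p ^ n) - 1) / p%:R ^+ n) (padic_log abs q).
Proof.
move=> qr; have /andP[s0 s1] := ratio_bounds qr.
have log_pn := abs_cvg_subseq Habs (fun n => ltnW (ltn_expl n p_gt1))
  (padic_log_cvg qr).
(* the difference of the terms of index [i] in the two sums *)
pose F n i := ('C((p ^ n).-1, i)%:R - (-1) ^+ i) * ((q - 1) ^+ i.+1 / i.+1%:R).
have D0 : abs_cvg abs (fun n => \sum_(i < p ^ n) F n i) 0.
  apply: (abs_cvg0_sum Habs _ (s := abs (q - 1) / rho)
    (B := abs (q - 1))) => // [n i|i].
    apply: absM_le1 (log_term_le _ _) => //; apply: absB_le => //.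
    by rewrite -[_ ^+ i]mulr1 abs_sign // abs1.
  apply: (abs_cvg0_geometric Habs (ltW invp_gt0) invp_lt1
    (B := (abs i`!%:R)^-1 * abs ((q - 1) ^+ i.+1 / i.+1%:R))) => n.
  by rewrite absM // mulrAC ler_wpM2r // mulrC bin_predp_near.
have := abs_cvgD Habs D0 log_pn; rewrite add0r.
apply: (eq_abs_cvg Habs) => n; rewrite -big_split exprB1_bin mulr_suml /=.
apply: eq_bigr => i _; rewrite /F.
have pn0 : (p ^ n)%:R != 0 :> K by rewrite natr_neq0 // expn_gt0 p_gt0.
have i0 : i.+1%:R != 0 :> K by rewrite natr_neq0.
have := mul_bin_diag (p ^ n) i => /(congr1 (fun m => m%:R : K)).
rewrite !natrM -natrX => E.
have -> : 'C(p ^ n, i.+1)%:R = (p ^ n)%:R * 'C((p ^ n).-1, i)%:R / i.+1%:R :> K.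
  by rewrite E mulrC mulKf.
move: i.+1%:R (p ^ n)%:R i0 pn0 => a b a0 b0.
by field; rewrite a0 b0.
Qed.

(** With [r = exp (log q) / q], both [exp (p ^ n * log q)] and [q ^+ (p ^ n)]
    equal [1 + p ^ n * log q] up to [o (p ^ n)], so [r ^+ (p ^ n) - 1] is
    [o (p ^ n)]; but its absolute value is exactly [p ^ - n * abs (r - 1)]. *)
Lemma padic_exp_log q : abs (q - 1) < rho ->
  padic_exp abs (padic_log abs q) = q.
Proof.
move=> qr; set L := padic_log abs q.
have L_le := abs_padic_log qr; have Lr := le_lt_trans L_le qr.
have absq : abs q = 1.
  by apply: abs_near1; rewrite // absBC // (lt_trans qr rho_lt1).
have q0 : q != 0.
  apply/eqP => q0; move: absq; rewrite q0 abs0 => /eqP.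
  by rewrite eq_sym oner_eq0.
set r := padic_exp abs L / q.
have rE : r - 1 = (padic_exp abs L - q) / q by rewrite mulrBl divff.
have r_near1 : abs (r - 1) < rho.
  rewrite rE absM absV // absq divr1; apply: le_lt_trans qr.
  have -> : padic_exp abs L - q = (padic_exp abs L - 1) - (q - 1) by ring.
  by apply: absB_le => //; apply: le_trans (abs_padic_expB1 Lr) L_le.
suff : r - 1 = 0.
  by move/eqP; rewrite rE mulf_eq0 invr_eq0 (negPf q0) orbF subr_eq0 => /eqP.
apply/(absval_eq0 Habs)/le_anti; rewrite abs_ge0 andbT.
(* [exp (p ^ n * log q) = 1 + p ^ n * log q + o (p ^ n)] *)
have V0 : abs_cvg abs (fun n =>
    (padic_exp abs (p%:R ^+ n * L) - 1 - p%:R ^+ n * L) / p%:R ^+ n) 0.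
  apply: (abs_cvg0_geometric Habs (ltW invp_gt0) invp_lt1
    (B := abs L / rho * abs L)) => n.
  have pnL : abs (p%:R ^+ n * L) = p%:R^-1 ^+ n * abs L.
    by rewrite absM absX // norm_p.
  have pnLr : abs (p%:R ^+ n * L) < rho.
    rewrite pnL; apply: le_lt_trans Lr.
    by rewrite ler_piMl // exprn_ile1 // ltW ?invp_gt0 ?invp_lt1.
  rewrite absM absV // absX // norm_p -exprVn invrK.
  apply: le_trans (ler_wpM2r _ (padic_exp_near pnLr)) _; first by rewrite exprn_ge0.
  rewrite pnL exprVn le_eqVlt; apply/orP; left; apply/eqP.
  have : p%:R ^+ n != 0 :> R by rewrite expf_neq0 // pnatr_eq0 -lt0n.
  have := gt_eqF rho_gt0; move: rho => a /negbT a0 b0; field.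
  by rewrite a0 b0.
have := abs_cvgD Habs (abs_cvgZ Habs (-1) (padic_log_limit qr))
  (abs_cvg_cst Habs L).
rewrite mulN1r addNr => /(abs_cvgD Habs V0); rewrite addr0 => /(abs_cvgP Habs) W0.
apply/ler_addgt0Pr => e /W0 [n /(_ n (leqnn n))]; rewrite subr0 add0r.
(* The sum [w] of both errors is the error [r ^+ (p ^ n) - 1] up to a factor
   of absolute value 1, divided by [p ^ n]. *)
set w := (X in abs X); suff -> : abs w = abs (r - 1) by [].
have pn0 : p%:R ^+ n != 0 :> K by rewrite expf_neq0 // natr_neq0.
have -> : w = (r ^+ (p ^ n) - 1) * q ^+ (p ^ n) / p%:R ^+ n.
  have -> : (r ^+ (p ^ n) - 1) * q ^+ (p ^ n) =
      padic_exp abs (p%:R ^+ n * L) - q ^+ (p ^ n).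
    by rewrite mulrBl mul1r -exprMn divfK // -natrX padic_expMn.
  by rewrite /w; field.
rewrite !absM absV !absX absq expr1n mulr1 norm_p abs_exprpXB1 //.
by rewrite mulrC mulKf // expf_neq0 // gt_eqF ?invp_gt0.
Qed.

Lemma qpow_natr q m : abs (1 - q) < rho -> qpow abs q m%:R = q ^+ m.
Proof.
rewrite absBC => qr; rewrite /qpow padic_expMn ?padic_exp_log //.
exact: le_lt_trans (abs_padic_log qr) qr.
Qed.

End Padic.

(** * The fermionic integral and the reflection formula *)

Section Fermionic.
Set Implicit Arguments.
Unset Strict Implicit.
Variables (R : realType) (p : nat) (K : fieldType) (abs : K -> R).
Hypothesis p_prime : prime p.
Hypothesis p_odd : odd p.
Hypothesis Habs : ultrametric_absval abs.
Hypothesis norm_p : abs p%:R = p%:R^-1.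
Hypothesis Kc : abs_complete abs.

Let abs_ge0 := absval_ge0 Habs.
Let absM := absvalM Habs.
Let abs0 := abs0 Habs.
Let abs1 := abs1 Habs.
Let absX := absX Habs.
Let absN := absN Habs.
Let absV := absV Habs.
Let absBC := absBC Habs.
Let abs_sign := abs_sign Habs.
Let p_gt0 : (0 < p)%N := prime_gt0 p_prime.

Local Notation rho := (p%:R `^ (- (p%:R - 1)^-1) : R).

(** A function on the integers that is uniformly continuous for the [p]-adic
    topology is the restriction of a continuous function on the [p]-adic
    integers.  It is bounded for that reason; boundedness is made part of the
    definition so that stability under products is immediate. *)
Definition padic_ucont (f : int -> K) : Prop :=
  (exists B, forall x, abs (f x) <= B) /\
  forall e : R, 0 < e -> exists N, forall n, (N <= n)%N ->
    forall x y : int, abs (f (x + y * (p ^ n)%:Z) - f x) <= e.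

Lemma padic_lipschitz_ucont (f : int -> K) B C :
  (forall x, abs (f x) <= B) ->
  (forall n (x y : int), abs (f (x + y * (p ^ n)%:Z) - f x) <= C * p%:R^-1 ^+ n) ->
  padic_ucont f.
Proof.
move=> fB fC; split=> [|e e0]; first by exists B.
have [N HN] := geometric_eventually_le C (ltW (invp_gt0 R p_prime))
  (invp_lt1 R p_prime) e0.
by exists N => n /HN Ce x y; apply: le_trans (fC n x y) Ce.
Qed.

Lemma padic_ucont_cst c : padic_ucont (fun=> c).
Proof.
split=> [|e e0]; first by exists (abs c).
by exists 0%N => *; rewrite subrr abs0 ltW.
Qed.

Lemma padic_ucontM f g :
  padic_ucont f -> padic_ucont g -> padic_ucont (fun x => f x * g x).
Proof.
move=> [[A fA] fu] [[B gB] gu]; have A0 := le_trans (abs_ge0 _) (fA 0).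
have B0 := le_trans (abs_ge0 _) (gB 0).
split=> [|e e0]; first by exists (A * B) => x; rewrite absM ler_pM.
have A1 : 0 < A + 1 by rewrite ltr_wpDl.
have B1 : 0 < B + 1 by rewrite ltr_wpDl.
have [M HM] := fu _ (divr_gt0 e0 B1); have [N HN] := gu _ (divr_gt0 e0 A1).
exists (maxn M N) => n; rewrite geq_max => /andP[/HM fn /HN gn] x y.
set z := x + _.
have -> : f z * g z - f x * g x = f z * (g z - g x) + (f z - f x) * g x by ring.
have small a b c : 0 <= a -> 0 <= b -> a <= c -> b <= e / (c + 1) -> a * b <= e.
  move=> a0 b0 ac be; have c1 : 0 < c + 1.
    by apply: lt_le_trans (ltr_wpDl a0 ltr01) _; rewrite lerD2r.
  apply: le_trans (ler_pM a0 b0 ac be) _.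
  by rewrite mulrCA ler_piMr ?ltW // ltr_pdivrMr // mul1r ltrDl.
apply: absD_le => //; rewrite absM; first exact: small (gn x y).
by rewrite mulrC; apply: small (fn x y).
Qed.

Lemma padic_ucontX f n : padic_ucont f -> padic_ucont (fun x => f x ^+ n).
Proof.
move=> fu; elim: n => [|n IH]; first exact: padic_ucont_cst.
suff -> : (fun x => f x ^+ n.+1) = fun x => f x * f x ^+ n.
  exact: padic_ucontM.
by apply/funext => x; rewrite exprS.
Qed.

Lemma padic_ucont_addr f a : padic_ucont f -> padic_ucont (fun x => f (x + a)).
Proof.
move=> [[B fB] fu]; split=> [|e /fu [N HN]]; first by exists B.
by exists N => n Nn x y; rewrite addrAC; apply: HN.
Qed.

Lemma padic_ucont_opp f : padic_ucont f -> padic_ucont (fun x => f (- x)).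
Proof.
move=> [[B fB] fu]; split=> [|e /fu [N HN]]; first by exists B.
by exists N => n Nn x y; rewrite opprD -mulNr; apply: HN.
Qed.

Lemma padic_ucont_reflect f : padic_ucont f -> padic_ucont (fun x => f (1 - x)).
Proof.
move=> /(padic_ucont_addr 1) /padic_ucont_opp.
by congr padic_ucont; apply/funext => x; rewrite addrC.
Qed.

Lemma padic_ucont_cvg f : padic_ucont f ->
  abs_cvg abs (fun n => f (p ^ n)%:Z) (f 0).
Proof.
move=> [_ fu]; apply/(abs_cvgP Habs) => e /fu [N HN].
by exists N => n Nn; have := HN n Nn 0 1; rewrite add0r mul1r.
Qed.

Definition altsum (f : int -> K) n := \sum_(i < n) (-1) ^+ i * f i%:Z.

Lemma altsumD f m n :
  altsum f (m + n) = altsum f m + (-1) ^+ m * altsum (fun x => f (x + m%:Z)) n.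
Proof.
rewrite /altsum big_split_ord /= mulr_sumr; congr (_ + _).
by apply: eq_bigr => i _; rewrite exprD PoszD [m%:Z + _]addrC mulrA.
Qed.

Lemma altsum1 f : altsum f 1 = f 0.
Proof. by rewrite /altsum big_ord1 mul1r. Qed.

Lemma odd_pX n : odd (p ^ n).
Proof. by rewrite oddX p_odd orbT. Qed.

Lemma sign_pX n : (-1) ^+ (p ^ n) = -1 :> K.
Proof. by rewrite -signr_odd odd_pX expr1. Qed.

Lemma abs_altsum_le f B n : 0 <= B -> (forall i : 'I_n, abs (f i%:Z) <= B) ->
  abs (altsum f n) <= B.
Proof.
by move=> B0 fB; apply: abs_sum_le => // i _; rewrite abs_sign fB.
Qed.

Lemma altsumB f g n :
  altsum f n - altsum g n = altsum (fun x => f x - g x) n.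
Proof. by rewrite /altsum -sumrB; apply: eq_bigr => i _; rewrite mulrBr. Qed.

(** The fermionic integral for [q = 1], where the factor [[p ^ n]_{-1}] is 1. *)
Definition altlim (f : int -> K) := abs_lim abs (fun n => altsum f (p ^ n)).

(** The sum over [b * p ^ n] terms splits into [b] blocks of odd length; up
    to a uniformly small error, they are equal with alternating signs, and
    only one survives when [b = p] is odd. *)
Lemma altlim_cvg f : padic_ucont f ->
  abs_cvg abs (fun n => altsum f (p ^ n)) (altlim f).
Proof.
move=> [_ fu]; apply: abs_cvg_of_steps => //.
apply/(abs_cvgP Habs) => e e0; have [N HN] := fu e e0; exists N => n /HN fn.
rewrite subr0; suff blocks b :
    abs (altsum f (b * p ^ n) - (odd b)%:R * altsum f (p ^ n)) <= e.
  by have := blocks p; rewrite p_odd mul1r expnS.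
elim: b => [|b IH].
  by rewrite mul0n /altsum big_ord0 mul0r subrr abs0 ltW.
have -> : (odd b.+1)%:R = (odd b)%:R + (-1) ^+ b :> K.
  by rewrite -signr_odd /=; case: (odd b); rewrite ?expr1 ?expr0 ?subrr ?add0r.
rewrite mulSn addnC altsumD mulrDl opprD addrACA absD_le //.
rewrite mulnC exprM sign_pX -mulrBr abs_sign altsumB.
apply: abs_altsum_le => [|i]; first exact: ltW.
by rewrite mulnC PoszM fn.
Qed.

Lemma altlim_sum (I : finType) (c : I -> K) (F : I -> int -> K) :
  (forall i, padic_ucont (F i)) ->
  altlim (fun x => \sum_i c i * F i x) = \sum_i c i * altlim (F i).
Proof.
move=> Fu; apply: abs_limE => //.
have := abs_cvg_sum Habs (index_enum I)
  (fun i => abs_cvgZ Habs (c i) (altlim_cvg (Fu i))).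
apply: (eq_abs_cvg Habs) => n.
under eq_bigr => i _ do rewrite /altsum mulr_sumr.
rewrite exchange_big; apply: eq_bigr => x _; rewrite mulr_sumr.
by apply: eq_bigr => i _; rewrite mulrCA.
Qed.

Lemma altlimZ c f : padic_ucont f ->
  altlim (fun x => c * f x) = c * altlim f.
Proof.
move=> fu; apply: abs_limE => //.
apply: (eq_abs_cvg Habs) (abs_cvgZ Habs c (altlim_cvg fu)) => n.
by rewrite mulr_sumr; apply: eq_bigr => x _; rewrite mulrCA.
Qed.

(** Appending or prepending one term to the alternating sum gives the same
    sum, and [f (p ^ n)] tends to [f 0]. *)
Lemma altlim_succ f : padic_ucont f ->
  altlim (fun x => f (x + 1)) = 2 * f 0 - altlim f.
Proof.
move=> fu; apply: abs_limE => //; rewrite -mulN1r.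
have := abs_cvgD Habs (abs_cvgD Habs (abs_cvg_cst Habs (f 0)) (padic_ucont_cvg fu))
  (abs_cvgZ Habs (-1) (altlim_cvg fu)).
have -> : f 0 + f 0 = 2 * f 0 by ring.
apply: (eq_abs_cvg Habs) => n.
have := altsumD f 1 (p ^ n); rewrite addnC altsumD !altsum1 sign_pX expr1.
by rewrite add0r !mulN1r => /(canRL (addrK _)) ->; ring.
Qed.

(** Reversing the order of summation over [i < p ^ n] replaces [f (i + 1)] by
    [f (p ^ n - i)], which is uniformly close to [f (- i)]; the signs agree
    because [p ^ n] is odd. *)
Lemma altlim_opp f : padic_ucont f ->
  altlim (fun x => f (- x)) = altlim (fun x => f (x + 1)).
Proof.
move=> fu; apply: abs_limE => //.
have D0 : abs_cvg abs (fun n => altsum (fun x => f (- x)) (p ^ n)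
    - altsum (fun x => f (x + 1)) (p ^ n)) 0.
  apply/(abs_cvgP Habs) => e e0; have [N HN] := fu.2 e e0.
  exists N => n /HN fn; rewrite subr0.
  have -> : altsum (fun x => f (x + 1)) (p ^ n)
      = altsum (fun x => f (- x + 1 * (p ^ n)%:Z)) (p ^ n).
    rewrite /altsum (reindex_inj rev_ord_inj); apply: eq_bigr => i _ /=.
    have ip := ltn_ord i; congr (_ * f _); last by lia.
    rewrite -signr_odd oddB // odd_pX /= negbK.
    by rewrite signr_odd.
  by rewrite altsumB; apply: abs_altsum_le => [|i]; [exact: ltW | rewrite absBC].
have := abs_cvgD Habs D0 (altlim_cvg (padic_ucont_addr 1 fu)); rewrite add0r.
by apply: (eq_abs_cvg Habs) => n; rewrite subrK.
Qed.

(** With [g x = f (x + 1)], this is [altlim_opp] for [g], followed by two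
    shifts. *)
Lemma altlim_reflect f : padic_ucont f ->
  altlim (fun x => f (1 - x)) = altlim f + 2 * (f 1 - f 0).
Proof.
move=> fu.
have -> : (fun x => f (1 - x)) = fun x => (fun y => f (y + 1)) (- x).
  by apply/funext => x; rewrite addrC.
have f1u := padic_ucont_addr 1 fu.
by rewrite (altlim_opp f1u) (altlim_succ f1u) altlim_succ // add0r; ring.
Qed.

Lemma two_neq0 : 2 != 0 :> K.
Proof. exact: (natr_neq0 p_prime Habs norm_p (n := 2)). Qed.

Section Deformation.
Variable q : K.
Hypothesis q_near1 : abs (1 - q) < rho.

Let q_near1' : abs (q - 1) < rho.
Proof. by rewrite absBC. Qed.

Lemma abs_q : abs q = 1.
Proof.
by apply: abs_near1 => //; apply: lt_trans q_near1 (rho_lt1 R p_prime).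
Qed.

Lemma q_neq0 : q != 0.
Proof.
by apply/eqP => q0; have := abs_q; rewrite q0 abs0 => /eqP; rewrite eq_sym oner_eq0.
Qed.

Lemma abs_qz (x : int) : abs (q ^ x) = 1.
Proof.
case: x => n; first by rewrite -exprnP absX abs_q expr1n.
by rewrite NegzE -exprnN absV absX abs_q expr1n invr1.
Qed.

Lemma abs_exprzB1_le (r : K) (y : int) : abs r = 1 -> abs (r ^ y - 1) <= abs (r - 1).
Proof.
move=> r1; have r0 : r != 0.
  by apply/eqP => r0; move: r1; rewrite r0 abs0 => /eqP; rewrite eq_sym oner_eq0.
have nat_case n : abs (r ^+ n - 1) <= abs (r - 1).
  rewrite subrX1 mulrC absM_le1 //; apply: abs_sum_le => // i _.
  by rewrite absX r1 expr1n.
case: y => n; first exact: nat_case.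
rewrite NegzE -exprnN.
have -> : r ^- n.+1 - 1 = - (r ^+ n.+1 - 1) / r ^+ n.+1.
  by rewrite mulNr mulrBl mul1r divff ?expf_neq0 // opprB.
by rewrite absM absN absV absX r1 expr1n divr1.
Qed.

(** Powers of [q] are Lipschitz for the [p]-adic distance between exponents,
    as [q ^+ (p ^ n) - 1] has absolute value [p ^- n * abs (q - 1)]. *)
Lemma abs_qz_period n (x y : int) :
  abs (q ^ (x + y * (p ^ n)%:Z) - q ^ x) <= abs (q - 1) * p%:R^-1 ^+ n.
Proof.
rewrite expfzDr ?q_neq0 // -{2}[q ^ x]mulr1 -mulrBr absM abs_qz mul1r.
rewrite mulrC -exprz_exp; apply: le_trans (abs_exprzB1_le _ _) _.
  exact: abs_qz.
by rewrite mulrC -(abs_exprpXB1 p_prime Habs norm_p).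
Qed.

Lemma padic_ucont_qz : padic_ucont (fun x => q ^ x).
Proof.
apply: (@padic_lipschitz_ucont _ 1 (abs (q - 1))) => [x|n x y].
  by rewrite abs_qz.
exact: abs_qz_period.
Qed.

(** On the integers integral powers replace the exponential; the reflection
    [x |-> 1 - x] makes negative arguments necessary. *)
Definition qnumz (r : K) (x : int) : K :=
  if r == 1 then x%:~R else (1 - r ^ x) / (1 - r).

Lemma padic_ucont_qnumz : padic_ucont (qnumz q).
Proof.
rewrite /qnumz; case: (eqVneq q 1) => [_|q1].
  apply: (padic_lipschitz_ucont (B := 1) (C := 1)) => [x|n x y].
    exact: abs_int_le1.
  rewrite intrD addrAC subrr add0r intrM mul1r absM_le1 ?abs_int_le1 //.
  by rewrite -pmulrn natrX absX norm_p.
apply: (padic_lipschitz_ucont (B := (abs (1 - q))^-1)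
          (C := abs (q - 1) / abs (1 - q))) => [x|n x y].
  rewrite absM absV ler_piMl ?invr_ge0 // absB_le ?abs1 ?abs_qz //.
rewrite -mulrBl absM absV mulrAC ler_wpM2r ?invr_ge0 //.
have -> a b : 1 - a - (1 - b) = - (a - b) :> K by ring.
by rewrite absN abs_qz_period.
Qed.

Lemma qnum_natr x : qnum abs q x%:R = qnumz q x.
Proof. by rewrite /qnum /qnumz (qpow_natr p_prime Habs norm_p Kc). Qed.

(** This formula is where [q^-1] enters the theorem. *)
Lemma qnumz_complement x : qnumz q^-1 (1 - x) = 1 - qnumz q x.
Proof.
rewrite /qnumz invr_eq1; case: (eqVneq q 1) => [_|q1].
  by rewrite intrB.
have q0 := q_neq0; have d0 : 1 - q != 0 by rewrite subr_eq0 eq_sym.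
rewrite exprz_inv opprB expfzDr // -[q ^ (-1)]/(q^-1).
field; rewrite q0 d0 /=.
by rewrite subr_eq0.
Qed.

Lemma near1_V : abs (1 - q^-1) < rho.
Proof.
have -> : 1 - q^-1 = - (1 - q) / q by have := q_neq0 => q0; field.
by rewrite absM absN absV abs_q divr1.
Qed.

Lemma abs_add1_near1 r : abs (1 - r) < 1 -> abs (1 + r) = 1.
Proof.
move=> r1; have -> : 1 + r = 2%:R - (1 - r) by ring.
have a2 : abs 2%:R = 1 by apply: (abs_coprime p_prime Habs norm_p); rewrite coprimen2.
by rewrite (abs_dominant Habs) ?a2 // absN.
Qed.

(** The normalizing factor [(1 + q) / (1 + q ^+ (p ^ n))] tends to
    [(1 + q) / 2]. *)
Lemma fermionic_integralE (f : K -> K) (g : int -> K) : padic_ucont g ->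
  (forall x : nat, f x%:R * q ^+ x = g x%:Z) ->
  fermionic_integral abs p q f = (1 + q) / 2 * altlim g.
Proof.
move=> gu fg; apply: abs_limE => //.
have q1 : abs (1 - q) < 1 := lt_trans q_near1 (rho_lt1 R p_prime).
have qM n : abs (1 - q ^+ (p ^ n)) = p%:R^-1 ^+ n * abs (1 - q).
  by rewrite absBC // (abs_exprpXB1 p_prime Habs norm_p) // [abs (q - 1)]absBC.
have qM1 n : abs (1 + q ^+ (p ^ n)) = 1.
  apply: abs_add1_near1; rewrite qM; apply: le_lt_trans q1; rewrite ler_piMl //.
  by rewrite exprn_ile1 // ltW ?invp_gt0 ?invp_lt1.
have qM0 n : 1 + q ^+ (p ^ n) != 0.
  apply/eqP => E; have := qM1 n; rewrite E abs0 => /eqP.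
  by rewrite eq_sym oner_eq0.
have norm_cvg : abs_cvg abs (fun n => (1 + q ^+ (p ^ n))^-1) 2^-1.
  have D0 : abs_cvg abs (fun n => (1 + q ^+ (p ^ n))^-1 - 2^-1) 0.
    apply: (abs_cvg0_geometric Habs (ltW (invp_gt0 R p_prime))
      (invp_lt1 R p_prime) (B := abs (1 - q) / abs 2)) => n.
    have -> : (1 + q ^+ (p ^ n))^-1 - 2^-1
        = (1 - q ^+ (p ^ n)) / 2 / (1 + q ^+ (p ^ n)).
      by field; rewrite two_neq0 qM0.
    by rewrite absM absV qM1 divr1 absM absV qM (mulrC (_ ^+ n)) mulrAC.
  have := abs_cvgD Habs D0 (abs_cvg_cst Habs 2^-1); rewrite add0r.
  by apply: (eq_abs_cvg Habs) => n; rewrite subrK.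
have := abs_cvgM Habs (abs_cvgZ Habs (1 + q) norm_cvg) (altlim_cvg gu).
apply: (eq_abs_cvg Habs) => n; rewrite /qnum_neg exprNn sign_pX mulN1r opprK.
rewrite invf_div; congr (_ * _); apply: eq_bigr => x _.
by rewrite (qpow_natr p_prime Habs norm_p Kc) // -mulrA fg.
Qed.

(** The integrand [q ^ ((h - 1) * x) * [x]_q ^+ m] multiplied by the density
    [q ^ x] of the measure. *)
Definition genocchi_fun (r : K) (h m : nat) (x : int) : K :=
  (r ^ x) ^+ h * qnumz r x ^+ m.

Lemma padic_ucont_genocchi_fun h m : padic_ucont (genocchi_fun q h m).
Proof.
apply: padic_ucontM; first exact: padic_ucontX padic_ucont_qz.
exact: padic_ucontX padic_ucont_qnumz.
Qed.

Lemma genocchiE h m : (0 < h)%N ->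
  genocchi abs p h q m.+1 / m.+1%:R = (1 + q) / 2 * altlim (genocchi_fun q h m).
Proof.
move=> h0; rewrite /genocchi /genocchi_poly mulrC mulKf; last first.
  exact: (natr_neq0 p_prime Habs norm_p).
apply: fermionic_integralE => [|x]; first exact: padic_ucont_genocchi_fun.
rewrite add0r qnum_natr -[1]/(1%:R) -natrB // -natrM.
rewrite (qpow_natr p_prime Habs norm_p Kc) // /genocchi_fun mulrAC.
congr (_ * _); rewrite -exprD -exprM; congr (_ ^+ _).
by rewrite subn1 -mulSnr prednK // mulnC.
Qed.

End Deformation.

(** The reflection [x |-> 1 - x] turns [1 - [x]_q] into [[x]_{q^-1}]; for
    [0 < m] the boundary term of the reflection is [f 1 = q ^- h]. *)
Lemma altlim_genocchi_complement q h m : abs (1 - q) < rho -> (0 < m)%N ->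
  altlim (fun x => (q ^ x) ^+ h * (1 - qnumz q x) ^+ m) =
  2 + q ^+ h * altlim (genocchi_fun q^-1 h m).
Proof.
move=> qr m0; have q0 := q_neq0 qr; set f := genocchi_fun q^-1 h m.
have fu : padic_ucont f by apply: padic_ucont_genocchi_fun; apply: near1_V.
have qh0 : q ^+ h != 0 by rewrite expf_neq0.
have -> : (fun x => (q ^ x) ^+ h * (1 - qnumz q x) ^+ m)
    = fun x => q ^+ h * f (1 - x).
  apply/funext => x; rewrite /f /genocchi_fun qnumz_complement // mulrA.
  by rewrite -exprMn exprz_inv opprB addrC expfzDr // mulrCA divff // mulr1.
rewrite altlimZ; last exact: padic_ucont_reflect.
rewrite altlim_reflect //.
have -> : f 0 = 0.
  rewrite /f /genocchi_fun /qnumz expr0z subrr mul0r if_same.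
  by rewrite expr0n gtn_eqF // mulr0.
have -> : f 1 = (q ^+ h)^-1.
  rewrite /f /genocchi_fun /qnumz expr1z exprVn; case: eqVneq => [_|q1].
    by rewrite expr1n mulr1.
  by rewrite divff ?expr1n ?mulr1 // subr_eq0 eq_sym.
by field.
Qed.

Lemma padic_ucont_complement q h m : abs (1 - q) < rho ->
  padic_ucont (fun x => (q ^ x) ^+ h * (1 - qnumz q x) ^+ m).
Proof.
move=> qr; apply: padic_ucontM; apply: padic_ucontX; first exact: padic_ucont_qz.
have -> : (fun x => 1 - qnumz q x) = fun x => qnumz q^-1 (1 - x).
  by apply/funext => x; rewrite qnumz_complement.
exact: padic_ucont_reflect (padic_ucont_qnumz (near1_V qr)).
Qed.

End Fermionic.

(** * The identity between Genocchi numbers *)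

(** This puts the left-hand side of the theorem under a single integral. *)
Lemma expand_complement_powers (K : comNzRingType) (x : K) (m k : nat) :
  \sum_(l < m.+1) 'C(m, l)%:R * (-1) ^+ l * x ^+ (l + k) = x ^+ k * (1 - x) ^+ m.
Proof.
rewrite exprDn mulr_sumr; apply: eq_bigr => l _.
by rewrite expr1n mul1r (exprNn x) exprD -[in RHS]mulr_natl; ring.
Qed.

(** Expanding [(1 - u) ^+ k] puts the right-hand side under a single integral
    of powers of [u = 1 - [x]_q]. *)
Lemma expand_powers_complement (K : comNzRingType) (u : K) (n k : nat) : (k <= n)%N ->
  \sum_(l < k.+1) 'C(k, l)%:R * (-1) ^+ (k + l) * u ^+ (n - l) =
  (1 - u) ^+ k * u ^+ (n - k).
Proof.
move=> kn; rewrite [1 - u]addrC exprDn mulr_suml; apply: eq_bigr => l _.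
have lk : (l <= k)%N by rewrite -ltnS.
have -> : (n - l = (k - l) + (n - k))%N by lia.
have -> : (-1) ^+ (k + l) = (-1) ^+ (k - l) :> K.
  by rewrite -signr_odd -[RHS]signr_odd oddD oddB.
by rewrite expr1n mulr1 (exprNn u) exprD -[in RHS]mulr_natl; ring.
Qed.

Theorem theorem6 (R : realType) (p : nat) (K : fieldType) (abs : K -> R)
  (q : K) (h n k : nat)
  (p_prime : prime p) (p_odd : odd p) (HK : is_Cp abs p)
  (hq : abs (1 - q) < p%:R `^ (- (p%:R - 1)^-1))
  (h_gt0 : (0 < h)%N) (lt_kn : (k < n)%N) :
  \sum_(l < (n - k).+1)
     'C(n - k, l)%:R * (-1) ^+ l * (genocchi abs p h q (l + k + 1) / (l + k + 1)%:R)
  = if k == 0%N then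
      qnum abs q 2%:R
      + qpow abs q (h%:R + 1) / (n + 1)%:R * genocchi abs p h q^-1 (n + 1)
    else
      \sum_(l < k.+1) 'C(k, l)%:R * (-1) ^+ (k + l) *
        (qnum abs q 2%:R
         + qpow abs q (h%:R + 1) / (n - l + 1)%:R
           * genocchi abs p h q^-1 (n - l + 1)).
Proof.
have Habs := Cp_absval HK; have norm_p := Cp_norm_p HK; have Kc := Cp_complete HK.
have q0 : q != 0 := q_neq0 p_prime Habs hq.
have two0 : 2 != 0 :> K := two_neq0 p_prime Habs norm_p.
pose A m := qnum abs q 2%:R
  + qpow abs q (h%:R + 1) / (m + 1)%:R * genocchi abs p h q^-1 (m + 1).
pose U m (x : int) := (q ^ x) ^+ h * (1 - qnumz q x) ^+ m.
have ucontU m : padic_ucont p abs (U m) by exact: padic_ucont_complement.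
(* [A m] is the fermionic [q]-integral of
   [q ^ ((h - 1) * x) * [1 - x]_{q^-1} ^+ m]. *)
have AE m : (0 < m)%N -> A m = (1 + q) / 2 * altlim p abs (U m).
  move=> m0; rewrite /A /U (altlim_genocchi_complement p_prime p_odd Habs norm_p Kc) //.
  rewrite mulrAC addn1 -mulrA
    (genocchiE p_prime p_odd Habs norm_p Kc) //; last exact: near1_V.
  have -> : h%:R + 1 = h.+1%:R :> K by rewrite natr1.
  rewrite (qpow_natr p_prime Habs norm_p Kc) // (qnum_natr p_prime Habs norm_p Kc) //.
  have -> : qnumz q 2 = 1 + q.
    rewrite /qnumz; case: eqVneq => [->//|q1].
    have d0 : 1 - q != 0 by rewrite subr_eq0 eq_sym.
    by rewrite -exprnP; field.
  by rewrite exprS; field; rewrite two0.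
suff -> : \sum_(l < (n - k).+1) 'C(n - k, l)%:R * (-1) ^+ l *
    (genocchi abs p h q (l + k + 1) / (l + k + 1)%:R) =
    \sum_(l < k.+1) 'C(k, l)%:R * (-1) ^+ (k + l) * A (n - l)%N.
  case: eqP lt_kn => // -> _.
  by rewrite big_ord1 bin0 expr0 !mul1r subn0.
under eq_bigr => l _ do
  rewrite addn1 (genocchiE p_prime p_odd Habs norm_p Kc) // mulrCA.
rewrite -mulr_sumr -(altlim_sum p_odd Habs Kc); last first.
  move=> l; exact: padic_ucont_genocchi_fun.
under [RHS]eq_bigr => l _ do
  rewrite AE ?subn_gt0 ?(leq_ltn_trans (leq_ord l)) // mulrCA.
rewrite -mulr_sumr -(altlim_sum p_odd Habs Kc) //.
congr (_ * altlim p abs _); apply/funext => x.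
rewrite /genocchi_fun /U.
under eq_bigr => l _ do rewrite mulrCA.
under [RHS]eq_bigr => l _ do rewrite mulrCA.
rewrite -!mulr_sumr expand_complement_powers expand_powers_complement ?(ltnW lt_kn) //.
by rewrite subKr.
Qed.
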